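(* Let $f(x,y)\in\mathbb{Z}[x,y]$ be a polynomial with no constant term. Then there are infinitely many pairs of positive integers $(x,y)$ for which $f(x,y)$ is not a prime number. *)

(* Defs.v *)
From mathcomp Require Export all_boot all_order all_algebra.
From mathcomp Require Export boolp classical_sets cardinality.
From mathcomp Require Export mpoly.

Set Implicit Arguments.
Unset Strict Implicit.
Unset Printing Implicit Defensive.

Import Order.TTheory GRing.Theory Num.Theory.
Local Open Scope ring_scope.

(* Variable 'X_0 is sent to x and 'X_1 to y. *)
Definition eval2 (f : {mpoly int[2]}) (x y : int) : int :=
  f.@[tnth [tuple x; y]].

(* Prime numbers are positive: -7 is not one. *)
Definition prime_number (z : int) : Prop :=
  exists2 p : nat, prime p & z = p%:Z.

(* Main.v *)
Require Import Defs.
From mathcomp Require Import all_boot all_order all_algebra.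
From mathcomp Require Import boolp classical_sets cardinality.
From mathcomp Require Import mpoly.

Import Order.TTheory GRing.Theory Num.Theory.
Local Open Scope ring_scope.
Local Open Scope classical_set_scope.

(** If [f] has no constant term, then [d] divides [f(x, y)] whenever it divides
    [x] and [y]. For [d = 4] this rules out primality at every pair of
    multiples of [4]. *)

(** The infinite family is the diagonal [(4k, 4k)], [k > 0]: [dvdz_meval] makes 4 divide the value,
    and [dvd4_not_prime_number] concludes. *)

Lemma dvdz_meval (n : nat) (f : {mpoly int[n]}) (d : int) (v : 'I_n -> int) :
  f@_(0%MM) = 0 -> (forall i, (d %| v i)%Z) -> (d %| f.@[v])%Z.
Proof.
move=> f0 dv; rewrite mevalE; apply: rpred_sum => m _.
have [-> | m0] := eqVneq m 0%MM; first by rewrite f0 mul0r dvdz0.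
have [i mi] : exists i, m i != 0%N.
  apply/existsP; apply: contraR m0 => /existsPn m0.
  by apply/eqP/mnmP => i; rewrite mnm0E; apply/eqP/negPn/m0.
rewrite (bigD1 i) //= dvdz_mull // dvdz_mulr //.
by rewrite -(prednK (n := m i)) ?lt0n // exprS dvdz_mulr.
Qed.

(** A divisor of a prime other than 1 is that prime, and 4 is composite. A prime modulus would not
    do: the value could be that prime itself. *)
Lemma dvd4_not_prime_number (z : int) : (4 %| z)%Z -> ~ prime_number z.
Proof.
move=> dz [p pr_p zp]; move: dz; rewrite zp => dp.
have p4 : 4%N = p by apply/(prime_nt_dvdP pr_p).
by move: pr_p; rewrite -p4.
Qed.

Theorem theorem1 (f : {mpoly int[2]}) (f_noconst : f@_(0%MM) = 0) :
  infinite_set [set xy : int * int |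
    [/\ 0 < xy.1, 0 < xy.2 & ~ prime_number (eval2 f xy.1 xy.2)]].
Proof.
pose g (n : nat) := ((4 * n.+1)%N%:Z, (4 * n.+1)%N%:Z).
have g_inj : injective g.
  by move=> m n /(congr1 fst)/eqP; rewrite eqz_nat eqn_pmul2l // => /eqP[].
(* As [g] is injective, its range is as large as [nat]; it remains to include this range in the
   set. *)
apply/infiniteP; rewrite -(card_le_eql (inj_card_eq (in2W g_inj))).
apply: subset_card_le => _ [n _ <-] /=; split=> //.
apply: dvd4_not_prime_number; apply: dvdz_meval => // i.
have d4 : (4 %| (4 * n.+1)%N%:Z)%Z by exact: dvdn_mulr.
by case: i => [[|[|]]].
Qed.
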